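(* Let $\mathcal{S}_2$ be the category of $2$-divisible semimedial left quasigroups (with homomorphisms) and let $\mathcal{Q}$ be the category whose objects are the pairs $((Q,\cdot),f)$, where $(Q,\cdot)$ is a quandle and $f\in\mathrm{Aut}(Q,\cdot)$, and whose morphisms $((Q_1,\cdot_1),f_1)\to((Q_2,\cdot_2),f_2)$ are the quandle homomorphisms $h:Q_1\to Q_2$ with $hf_1=f_2h$. The assignments $$((Q,\cdot),f)\mapsto (Q,*_f),\qquad x*_f y=f(x\cdot y),$$ $$(S,* )\mapsto ((S,\cdot_{\mathfrak{s}}),\mathfrak{s}),\qquad x\cdot_{\mathfrak{s}}y=\mathfrak{s}^{-1}(x*y),$$ (acting as the identity on underlying maps of morphisms) are mutually inverse and define an isomorphism of categories between $\mathcal{Q}$ and $\mathcal{S}_2$ which preserves the displacement groups, i.e. $\mathrm{Dis}(Q,\cdot)=\mathrm{Dis}(Q,*_f)$ for every $((Q,\cdot),f)\in\mathcal{Q}$ and $\mathrm{Dis}(S,* )=\mathrm{Dis}(S,\cdot_{\mathfrak{s}})$ for every $(S,* )\in\mathcal{S}_2$. In particular, for $((Q,\cdot),f)\in\mathcal{Q}$, $(Q,*_f)$ is a rack if and only if $f\in C_{\mathrm{Aut}(Q,\cdot)}(\mathrm{LMlt}(Q,\cdot))$.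
   Context: A left quasigroup is a set $Q$ with a binary operation $*$ such that every $L_x:y\mapsto x*y$ is a bijection of $Q$ (with $x\backslash y=L_x^{-1}(y)$). It is semimedial if $(x*x)*(y*z)=(x*y)*(x*z)$ for all $x,y,z$; a rack if $x*(y*z)=(x*y)*(x*z)$ for all $x,y,z$; a quandle if it is a rack and $x*x=x$ for all $x$. The squaring map is $\mathfrak{s}:a\mapsto a*a$; the left quasigroup is $2$-divisible if $\mathfrak{s}$ is a bijection. $\mathrm{LMlt}(Q)=\langle L_a: a\in Q\rangle\leq\mathrm{Sym}_Q$ and $\mathrm{Dis}(Q)$ is the normal closure in $\mathrm{LMlt}(Q)$ of $\{L_aL_b^{-1}:a,b\in Q\}$; the operation is indicated when needed, e.g. $\mathrm{Dis}(Q,\cdot)$. Equality of displacement groups means equality as subgroups of the symmetric group of the underlying set. $C_G(H)$ denotes the centralizer of $H$ in $G$ (for a quandle, $\mathrm{LMlt}(Q,\cdot)\leq\mathrm{Aut}(Q,\cdot)$). *)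

(* Defs.v *)
From HB Require Import structures.
From mathcomp Require Import all_boot.
From mathcomp Require Import boolp classical_sets.

Set Implicit Arguments.
Unset Strict Implicit.
Unset Printing Implicit Defensive.

Local Open Scope classical_set_scope.
Local Open Scope group_scope.

Record Sym (T : Type) := MkSym {
  sym_fun :> T -> T;
  sym_bij : bijective sym_fun }.

Section SymGroup.
Variable T : Type.
Implicit Types f g h : Sym T.

Lemma sym_eq f g : f =1 g -> f = g.
Proof.
case: f g => [f fB] [g gB] /= /funext fg.
by move: fB; rewrite fg => fB; congr MkSym; exact: Prop_irrelevance.
Qed.

Lemma sym_inv_ex f : exists g : T -> T, cancel f g /\ cancel g f.
Proof. by case: (sym_bij f) => g fK gK; exists g. Qed.

Definition sym_inv_fun f : T -> T := sval (cid (sym_inv_ex f)).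

Lemma sym_funK f : cancel f (sym_inv_fun f).
Proof. exact: (svalP (cid (sym_inv_ex f))).1. Qed.

Lemma sym_invK f : cancel (sym_inv_fun f) f.
Proof. exact: (svalP (cid (sym_inv_ex f))).2. Qed.

Definition sym_one : Sym T :=
  @MkSym T id (@Bijective _ _ id id (fun=> erefl) (fun=> erefl)).

(* Permutations act on the left: [(f * g) x = f (g x)] (unlike in [perm]). *)
Definition sym_mul f g : Sym T := MkSym (bij_comp (sym_bij f) (sym_bij g)).

Definition sym_inv f : Sym T :=
  MkSym (Bijective (sym_invK f) (sym_funK f)).

Lemma sym_mulA : associative sym_mul.
Proof. by move=> f g h; exact: sym_eq. Qed.

Lemma sym_mul1 : left_id sym_one sym_mul.
Proof. by move=> f; exact: sym_eq. Qed.

Lemma sym_mulr1 : right_id sym_one sym_mul.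
Proof. by move=> f; exact: sym_eq. Qed.

Lemma sym_mulV : left_inverse sym_one sym_inv sym_mul.
Proof. by move=> f; apply: sym_eq => x; exact: sym_funK. Qed.

Lemma sym_mulrV : right_inverse sym_one sym_inv sym_mul.
Proof. by move=> f; apply: sym_eq => x; exact: sym_invK. Qed.

HB.instance Definition _ := gen_eqMixin (Sym T).
HB.instance Definition _ := gen_choiceMixin (Sym T).
HB.instance Definition _ := isGroup.Build (Sym T)
  sym_mulA sym_mul1 sym_mulr1 sym_mulV sym_mulrV.

End SymGroup.

Section Subgroups.
Variable G : groupType.
Implicit Types A H N : set G.

Definition subgroup H : Prop := group_closed (mem H).

Definition normal_subgroup H N : Prop :=
  [/\ subgroup N, N `<=` H & forall x y, N x -> H y -> N (x ^ y)].

Definition generated A : set G := smallest subgroup A.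

(* Meant for [H] a subgroup and [A `<=` H]. *)
Definition normal_closure H A : set G := smallest (normal_subgroup H) A.

(* The centralizer in [A] of [H]. *)
Definition centralizer A H : set G :=
  [set x | A x /\ forall y, H y -> commute x y].

End Subgroups.

Record leftQuasigroup := LeftQuasigroup {
  lq_sort :> Type;
  lq_op : lq_sort -> lq_sort -> lq_sort;
  lq_bij : forall x, bijective (lq_op x) }.

Notation "x *q y" := (lq_op x y) (at level 40, left associativity).

Section LeftQuasigroupTheory.
Variable Q : leftQuasigroup.

Definition semimedial : Prop :=
  forall x y z : Q, (x *q x) *q (y *q z) = (x *q y) *q (x *q z).

Definition rack : Prop :=
  forall x y z : Q, x *q (y *q z) = (x *q y) *q (x *q z).

Definition quandle : Prop := rack /\ forall x : Q, x *q x = x.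

Definition squaring (x : Q) : Q := x *q x.

Definition two_divisible : Prop := bijective squaring.

Definition ltrans (x : Q) : Sym Q := MkSym (lq_bij x).

Definition LMlt : set (Sym Q) := generated (range ltrans).

Definition Dis : set (Sym Q) :=
  normal_closure LMlt [set g | exists a b, g = ltrans a * (ltrans b)^-1].

Definition Aut : set (Sym Q) := [set f | {morph f : x y / x *q y}].

End LeftQuasigroupTheory.

Arguments LMlt Q : clear implicits.
Arguments Dis Q : clear implicits.
Arguments Aut Q : clear implicits.

(* The left quasigroup with operation [f (x *q y)] on the underlying set of
   [Q]: it is (Q, *_f) for a quandle with automorphism [f], and (S, ._s) when
   [f] is the inverse of the squaring map of [S]. *)
Definition lq_twist (Q : leftQuasigroup) (f : Sym Q) : leftQuasigroup :=
  @LeftQuasigroup Q (fun x y => f (x *q y))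
    (fun x => bij_comp (sym_bij f) (lq_bij x)).
Arguments lq_twist Q f : clear implicits.

Record category := Category {
  obj :> Type;
  hom : obj -> obj -> Type;
  idm : forall X, hom X X;
  compm : forall X Y Z, hom Y Z -> hom X Y -> hom X Z;
  comp1m : forall X Y (u : hom X Y), compm (idm Y) u = u;
  compm1 : forall X Y (u : hom X Y), compm u (idm X) = u;
  compmA : forall X Y Z W (w : hom Z W) (v : hom Y Z) (u : hom X Y),
    compm w (compm v u) = compm (compm w v) u }.

Record functor (C D : category) := Functor {
  fobj :> C -> D;
  fmap : forall X Y : C, hom X Y -> hom (fobj X) (fobj Y);
  fmap1 : forall X : C, fmap (idm X) = idm (fobj X);
  fmapM : forall (X Y Z : C) (v : hom Y Z) (u : hom X Y),
    fmap (compm v u) = compm (fmap v) (fmap u) }.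

Definition functor_id (C : category) : functor C C :=
  @Functor C C id (fun _ _ => id) (fun=> erefl) (fun _ _ _ _ _ => erefl).

Section FunctorComp.
Variables (C D E : category) (G : functor D E) (F : functor C D).

Lemma functor_comp1 (X : C) : fmap G (fmap F (idm X)) = idm (G (F X)).
Proof. by rewrite !fmap1. Qed.

Lemma functor_compM (X Y Z : C) (v : hom Y Z) (u : hom X Y) :
  fmap G (fmap F (compm v u)) = compm (fmap G (fmap F v)) (fmap G (fmap F u)).
Proof. by rewrite !fmapM. Qed.

Definition functor_comp : functor C E :=
  @Functor C E (fun X => G (F X)) (fun _ _ u => fmap G (fmap F u))
    functor_comp1 functor_compM.

End FunctorComp.

(* Equality on the nose of both composites with the identity functors. *)
Definition mutually_inverse (C D : category)
    (F : functor C D) (G : functor D C) : Prop :=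
  functor_comp G F = functor_id C /\ functor_comp F G = functor_id D.

Definition lq_hom (Q R : leftQuasigroup) (h : Q -> R) : Prop :=
  {morph h : x y / x *q y}.

Lemma lq_hom_id (Q : leftQuasigroup) : lq_hom (@id Q).
Proof. by []. Qed.

Lemma lq_hom_comp (Q R S : leftQuasigroup) (k : R -> S) (h : Q -> R) :
  lq_hom k -> lq_hom h -> lq_hom (k \o h).
Proof. by move=> kM hM x y /=; rewrite hM kM. Qed.

Record S2_obj := S2Obj {
  S2_lq :> leftQuasigroup;
  S2_semimedial : semimedial S2_lq;
  S2_two_divisible : two_divisible S2_lq }.

Definition S2_squaring (S : S2_obj) : Sym S := MkSym (S2_two_divisible S).

Definition S2_hom (S T : S2_obj) : Type := {h : S -> T | lq_hom h}.

Definition S2_id (S : S2_obj) : S2_hom S S := exist _ id (@lq_hom_id S).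

Definition S2_comp (S T U : S2_obj) (k : S2_hom T U) (h : S2_hom S T) :
    S2_hom S U :=
  exist _ (sval k \o sval h) (lq_hom_comp (svalP k) (svalP h)).

Lemma S2_comp1m (S T : S2_obj) (u : S2_hom S T) : S2_comp (S2_id T) u = u.
Proof. by case: u => u uM; exact: eq_exist. Qed.

Lemma S2_compm1 (S T : S2_obj) (u : S2_hom S T) : S2_comp u (S2_id S) = u.
Proof. by case: u => u uM; exact: eq_exist. Qed.

Lemma S2_compmA (S T U V : S2_obj)
    (w : S2_hom U V) (v : S2_hom T U) (u : S2_hom S T) :
  S2_comp w (S2_comp v u) = S2_comp (S2_comp w v) u.
Proof. exact: eq_exist. Qed.

Definition catS2 : category := Category S2_comp1m S2_compm1 S2_compmA.

Record QA_obj := QAObj {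
  QA_lq :> leftQuasigroup;
  QA_aut : Sym QA_lq;
  QA_quandle : quandle QA_lq;
  QA_autP : Aut QA_lq QA_aut }.

Definition QA_morph (P R : QA_obj) (h : P -> R) : Prop :=
  lq_hom h /\ h \o QA_aut P = QA_aut R \o h.

Lemma QA_morph_id (P : QA_obj) : QA_morph (@id P).
Proof. by []. Qed.

Lemma QA_morph_comp (P R S : QA_obj) (k : R -> S) (h : P -> R) :
  QA_morph k -> QA_morph h -> QA_morph (k \o h).
Proof.
move=> [kM kf] [hM hf]; split; first exact: lq_hom_comp.
by rewrite -compA hf compA kf.
Qed.

Definition QA_hom (P R : QA_obj) : Type := {h : P -> R | QA_morph h}.

Definition QA_id (P : QA_obj) : QA_hom P P := exist _ id (@QA_morph_id P).

Definition QA_comp (P R S : QA_obj) (k : QA_hom R S) (h : QA_hom P R) :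
    QA_hom P S :=
  exist _ (sval k \o sval h) (QA_morph_comp (svalP k) (svalP h)).

Lemma QA_comp1m (P R : QA_obj) (u : QA_hom P R) : QA_comp (QA_id R) u = u.
Proof. by case: u => u uM; exact: eq_exist. Qed.

Lemma QA_compm1 (P R : QA_obj) (u : QA_hom P R) : QA_comp u (QA_id P) = u.
Proof. by case: u => u uM; exact: eq_exist. Qed.

Lemma QA_compmA (P R S T : QA_obj)
    (w : QA_hom S T) (v : QA_hom R S) (u : QA_hom P R) :
  QA_comp w (QA_comp v u) = QA_comp (QA_comp w v) u.
Proof. exact: eq_exist. Qed.

Definition catQ : category := Category QA_comp1m QA_compm1 QA_compmA.

(* A map bundled with its source and target, so that maps whose sources and
   targets are only propositionally equal sets can be compared. *)
Record set_map := SetMap {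
  sm_source : Type;
  sm_target : Type;
  sm_fun : sm_source -> sm_target }.

Definition S2_map (S T : S2_obj) (h : S2_hom S T) : set_map :=
  SetMap (sval h).

Definition QA_map (P R : QA_obj) (h : QA_hom P R) : set_map :=
  SetMap (sval h).

(* A left quasigroup bundled with a permutation of its underlying set. *)
Definition lq_perm : Type := {Q : leftQuasigroup & Sym Q}.

Definition LqPerm (Q : leftQuasigroup) (f : Sym Q) : lq_perm :=
  existT (fun Q : leftQuasigroup => Sym Q) Q f.
Arguments LqPerm Q f : clear implicits.

(* Main.v *)
(** Twisting by an automorphism [f] turns the left translation [L_a] into
    [f L_a], so that [(f L_a) (f L_b)^-1 = L_(f a) L_(f b)^-1]: as [f] is onto,
    the set of generators [L_a L_b^-1] of the displacement group does not
    change.  In a quandle this set is stable under conjugation by every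
    automorphism; both multiplication groups consist of automorphisms of the
    quandle, hence both normal closures are the plain subgroup generated by this
    set. *)

Require Import Defs.
From mathcomp Require Import all_boot.
From mathcomp Require Import boolp classical_sets.

Set Implicit Arguments.
Unset Strict Implicit.
Unset Printing Implicit Defensive.

Local Open Scope classical_set_scope.
Local Open Scope group_scope.

(** * Subgroups and normal closures *)

Section SubgroupTheory.
Variable G : groupType.
Implicit Types (A H : set G) (x y : G).

Lemma subgroupP H :
  subgroup H <-> H 1 /\ forall x y, H x -> H y -> H (x / y).
Proof.
split=> [[H1 HD]|[H1 HD]]; split; rewrite ?mem_setE //.
- by move: H1; rewrite inE.
- move=> x y Hx Hy; have := HD x y; rewrite !inE; exact.
- by rewrite inE.
- by move=> x y; rewrite !inE; exact: HD.
Qed.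

Lemma subgroup_generated A : subgroup (generated A).
Proof.
apply/subgroupP; split=> [H [/subgroupP[]] //|x y Ax Ay H HA].
by case: (HA) => /subgroupP[_ HD] _; apply: HD; [exact: Ax|exact: Ay].
Qed.

Lemma subgroup_preim_conj H y : subgroup H -> subgroup [set x | H (x ^ y)].
Proof.
move=> /subgroupP[H1 HD]; apply/subgroupP; split=> /= [|x z Hx Hz].
  by rewrite conj1g.
by rewrite conjMg conjVg; exact: HD.
Qed.

Lemma subgroup_commute x : subgroup [set y | commute x y].
Proof.
apply/subgroupP; split=> [|y z xy xz] /=; first exact: commute1.
by apply: commuteM => //; exact: commuteV.
Qed.

(** Conjugation by [y] in [H] maps [A] into itself, and the elements whose conjugate by [y] lies in
    [generated A] form a subgroup; so [generated A] is already normal in [H]. *)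
Lemma normal_closure_generated H A : subgroup H -> A `<=` H ->
  (forall x y, A x -> H y -> A (x ^ y)) -> normal_closure H A = generated A.
Proof.
move=> sH sAH AJ; apply/seteqP; split.
  apply: smallest_sub; last exact: sub_gen_smallest.
  split; [exact: subgroup_generated|exact: smallest_sub|move=> x y Ax Hy].
  move: x Ax; apply: smallest_sub.
    by apply: subgroup_preim_conj; exact: subgroup_generated.
  by move=> x Ax; apply: sub_gen_smallest; exact: AJ.
by move=> x Ax M [[sM _ _] sAM]; exact: Ax.
Qed.

End SubgroupTheory.

(** * Displacement groups and twisting *)

Section Displacement.
Variable Q : leftQuasigroup.
Implicit Types f : Sym Q.

Definition displacements : set (Sym Q) :=
  [set g | exists a b, g = ltrans a * (ltrans b)^-1].

Lemma displacements_LMlt : displacements `<=` LMlt Q.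
Proof.
have /subgroupP[_ HD] := subgroup_generated (range (@ltrans Q)).
move=> _ [a [b ->]]; apply: HD; apply: sub_gen_smallest.
  by exists a.
by exists b.
Qed.

Lemma subgroup_Aut : subgroup (Aut Q).
Proof.
apply/subgroupP; split=> [x y //|f g fM gM x y].
rewrite /= -[in LHS](sym_invK g x) -[in LHS](sym_invK g y) -gM.
by rewrite sym_funK fM.
Qed.

(** Here [g ^ f] is [f^-1 * g * f], whence [f^-1 a] and not [f a]. *)
Lemma ltrans_conj f a : Aut Q f -> ltrans a ^ f = ltrans (f^-1 a).
Proof.
move=> fM; rewrite conjgE; apply: sym_eq => x /=.
apply: (canLR (sym_funK f)).
by rewrite fM sym_invK.
Qed.

Lemma displacements_conj f g :
  Aut Q f -> displacements g -> displacements (g ^ f).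
Proof.
move=> fM [a [b ->]]; exists (f^-1 a), (f^-1 b).
by rewrite conjMg conjVg !ltrans_conj.
Qed.

Lemma rack_LMlt_Aut : rack Q -> LMlt Q `<=` Aut Q.
Proof.
move=> rQ; apply: smallest_sub => [|_ [a _ <-] x y]; last exact: rQ.
exact: subgroup_Aut.
Qed.

Lemma Dis_generated : LMlt Q `<=` Aut Q -> Dis Q = generated displacements.
Proof.
move=> sLA; apply: (@normal_closure_generated _ _ displacements).
- exact: subgroup_generated.
- exact: displacements_LMlt.
by move=> g h gD /sLA hA; exact: displacements_conj.
Qed.

End Displacement.

Arguments displacements Q : clear implicits.

Lemma displacements_twist (Q : leftQuasigroup) (f : Sym Q) : Aut Q f ->
  displacements (lq_twist Q f) = displacements Q :> set (Sym Q).
Proof.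
move=> fM.
have E (a b : Q) : ltrans (a : lq_twist Q f) * (ltrans (b : lq_twist Q f))^-1 =
    ltrans (f a) * (ltrans (f b))^-1 :> Sym Q.
  (* The factor [f] on the right cancels in the quotient of two such translations. *)
  have LE (c : Q) : ltrans (c : lq_twist Q f) = ltrans (f c) * f :> Sym Q.
    by apply: sym_eq => x /=; rewrite fM.
  have -> : ltrans (a : lq_twist Q f) * (ltrans (b : lq_twist Q f))^-1 =
    (ltrans (f a) * f) * (ltrans (f b) * f)^-1 by rewrite -!LE.
  by rewrite invgM mulgA mulgK.
apply/seteqP; split=> [_ [a [b ->]]|_ [a [b ->]]].
  by exists (f a), (f b); exact: E.
exists (f^-1 a), (f^-1 b).
by apply: esym; apply: etrans (E _ _) _; rewrite /= !sym_invK.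
Qed.

Lemma LMlt_twist_Aut (Q : leftQuasigroup) (f : Sym Q) : rack Q -> Aut Q f ->
  LMlt (lq_twist Q f) `<=` (Aut Q : set (Sym Q)).
Proof.
move=> rQ fM; apply: smallest_sub => [|_ [a _ <-] x y /=].
  exact: subgroup_Aut.
by rewrite rQ fM.
Qed.

Lemma Dis_twist (Q : leftQuasigroup) (f : Sym Q) : rack Q -> Aut Q f ->
  Dis Q = Dis (lq_twist Q f) :> set (Sym Q).
Proof.
move=> rQ fM.
rewrite (Dis_generated (rack_LMlt_Aut rQ)) -(displacements_twist fM).
apply: esym.
apply: (@normal_closure_generated (Sym Q) _ (displacements (lq_twist Q f))).
- exact: subgroup_generated.
- exact: (@displacements_LMlt (lq_twist Q f)).
rewrite (displacements_twist fM) => g h gD hL.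
by apply: displacements_conj gD; exact: LMlt_twist_Aut hL.
Qed.

(** * From quandles with an automorphism to semimedial left quasigroups *)

Section QuandleToS2.
Variable X : QA_obj.
Let f := QA_aut X.

Lemma twist_squaring (x : X) : squaring (x : lq_twist X f) = f x.
Proof. by rewrite /squaring /= (QA_quandle X).2. Qed.

(** As [x] squares to [f x] in the twist, the two sides are [f \o f] applied to the two sides of
    left distributivity. *)
Lemma twist_semimedial : semimedial (lq_twist X f).
Proof.
move=> x y z; have fM := @QA_autP X; have [rX iX] := QA_quandle X.
by rewrite /= iX -!fM rX.
Qed.

Lemma twist_two_divisible : two_divisible (lq_twist X f).
Proof. by rewrite /two_divisible (funext twist_squaring); exact: sym_bij. Qed.

Definition S2_of_QA : S2_obj := S2Obj twist_semimedial twist_two_divisible.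

Lemma S2_squaring_of_QA : S2_squaring S2_of_QA = f.
Proof. by apply: sym_eq; exact: twist_squaring. Qed.

Lemma twist_rackP : rack (lq_twist X f) <-> centralizer (Aut X) (LMlt X) f.
Proof.
have fM := @QA_autP X; have [rX _] := QA_quandle X; split=> [rf|[_ fC] x y z].
  split=> //; apply: smallest_sub => [|_ [x _ <-]].
    exact: subgroup_commute.
  (* Writing [z] as [x *q u] turns the rack law at [x], [x], [u] into
     [f (x *q f z) = f (f (x *q z))], and [f] is injective. *)
  apply: sym_eq => z /=; pose u := (ltrans (x : X))^-1 z.
  have xu : x *q u = z by exact: (sym_invK (ltrans x)).
  by have := rf x x u; rewrite /= -!fM -rX xu => /(bij_inj (sym_bij f)).
have {}fC (a b : X) : f (a *q b) = a *q f b.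
  have La : LMlt X (ltrans a) by apply: sub_gen_smallest; exists a.
  exact: (congr1 (fun g : Sym X => g b) (fC _ La)).
by rewrite /= -fM -rX -fC.
Qed.

End QuandleToS2.

(** * Transport along equal operations on one carrier *)

Section SameOperation.
Variables (T : Type) (op1 op2 : T -> T -> T).
Hypothesis op12 : op1 =2 op2.

(** The bijectivity proof depends on the operation, so both are replaced together and the proofs are
    then identified by irrelevance. *)
Lemma lq_op_subst (P : forall op : T -> T -> T,
    (forall x, bijective (op x)) -> Prop) b1 b2 :
  P op1 b1 -> P op2 b2.
Proof.
have e : op1 = op2 by apply/funext => x; apply/funext => y; exact: op12.
by move: b1 b2; rewrite e => b1 b2; rewrite (Prop_irrelevance b1 b2).
Qed.

Variables (b1 : forall x, bijective (op1 x)) (b2 : forall x, bijective (op2 x)).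

Lemma lq_eq : LeftQuasigroup b1 = LeftQuasigroup b2.
Proof.
exact: (@lq_op_subst (fun _ b => LeftQuasigroup b1 = LeftQuasigroup b) b1).
Qed.

Lemma LqPerm_eq (f1 f2 : Sym T) : f1 =1 f2 ->
  LqPerm (LeftQuasigroup b1) f1 = LqPerm (LeftQuasigroup b2) f2.
Proof.
move=> /sym_eq ->; exact: (@lq_op_subst
  (fun _ b => LqPerm (LeftQuasigroup b1) f2 = LqPerm (LeftQuasigroup b) f2) b1).
Qed.

Lemma Dis_eq :
  Dis (LeftQuasigroup b1) = Dis (LeftQuasigroup b2) :> set (Sym T).
Proof.
exact: (@lq_op_subst (fun _ b =>
  Dis (LeftQuasigroup b1) = Dis (LeftQuasigroup b) :> set (Sym T)) b1).
Qed.

End SameOperation.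

Lemma twist_twistV (Q : leftQuasigroup) (f : Sym Q) :
  lq_twist (lq_twist Q f^-1) f = Q.
Proof. by case: Q f => T op b f; apply: lq_eq => x y; exact: sym_invK. Qed.

(** Rewriting with [twist_twistV] would change the type [Sym] of the elements; [Dis_eq] works over a
    fixed carrier. *)
Lemma Dis_twist_twistV (Q : leftQuasigroup) (f : Sym Q) :
  Dis (lq_twist (lq_twist Q f^-1) f) = Dis Q :> set (Sym Q).
Proof. by case: Q f => T op b f; apply: Dis_eq => x y; exact: sym_invK. Qed.

(** * From semimedial left quasigroups to quandles *)

Section S2ToQuandle.
Variable S : S2_obj.
Let s := S2_squaring S.
Let T := lq_twist S s^-1.

(** This is the case [z = y] of semimediality. *)
Lemma squaringM : {morph s : x y / x *q y}.
Proof. by move=> x y; rewrite /= /squaring -S2_semimedial. Qed.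

Lemma squaringVM : {morph s^-1 : x y / x *q y}.
Proof.
move=> x y; apply: (canLR (sym_funK s)).
by rewrite squaringM !sym_invK.
Qed.

(** Since [s^-1 (x *q x) = x], applying the automorphism [s^-1] to semimediality replaces the factor
    [x *q x] by [x], which is left distributivity up to an outer [s^-1]. *)
Lemma untwist_quandle : quandle T.
Proof.
split=> [x y z|x] /=; last exact: (sym_funK s).
congr sym_inv_fun; rewrite -[RHS]squaringVM -S2_semimedial squaringVM.
by congr (_ *q _); exact/esym/(sym_funK s).
Qed.

Lemma untwist_aut : Aut T s.
Proof.
have E (x y : S) : s (s^-1 (x *q y)) = s^-1 (s x *q s y).
  by rewrite -squaringM sym_invK; exact/esym/(sym_funK s).
exact: E.
Qed.

Definition QA_of_S2 : QA_obj := QAObj untwist_quandle untwist_aut.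

End S2ToQuandle.

(** * Equality of objects, maps and functors *)

Lemma QA_obj_eq (P R : QA_obj) :
  LqPerm P (QA_aut P) = LqPerm R (QA_aut R) -> P = R.
Proof.
case: P R => [P f qP fP] [R g qR gR] /= e.
(* With a variable [p] on the right, the equality of pairs can be eliminated. *)
have E p (qp : quandle (projT1 p)) (fp : Aut (projT1 p) (projT2 p)) :
    LqPerm P f = p -> QAObj qP fP = QAObj qp fp.
  move=> pE; case: _ / pE qp fp => /= qp fp.
  by rewrite (Prop_irrelevance qp qP) (Prop_irrelevance fp fP).
exact: (E (LqPerm R g) qR gR e).
Qed.

Lemma S2_obj_eq (S T : S2_obj) : S2_lq S = S2_lq T -> S = T.
Proof.
case: S T => [S mS dS] [T mT dT] /= e; case: _ / e mT dT => mT dT.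
by rewrite (Prop_irrelevance mS mT) (Prop_irrelevance dS dT).
Qed.

Lemma SetMap_inj (A B : Type) : injective (@SetMap A B).
Proof.
move=> f g e.
(* [cast] reads a bundled map back as a map from [A] to [B]; irrelevance of the type equalities
   makes it the identity on [SetMap f]. *)
pose cast m (eA : sm_source m = A) (eB : sm_target m = B) : A -> B :=
  eq_rect _ (fun A' => A' -> B)
    (eq_rect _ (fun B' => sm_source m -> B') (@sm_fun m) _ eB) _ eA.
have E m eA eB : SetMap f = m -> cast m eA eB = f.
  by move=> mE; case: _ / mE eA eB => eA eB; rewrite /cast
    (Prop_irrelevance eA erefl) (Prop_irrelevance eB erefl).
by rewrite -(E (SetMap g) erefl erefl e).
Qed.

Lemma S2_map_inj (S T : S2_obj) : injective (@S2_map S T).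
Proof. by move=> [h hM] [k kM] /SetMap_inj /= hk; exact: eq_exist. Qed.

Lemma QA_map_inj (P R : QA_obj) : injective (@QA_map P R).
Proof. by move=> [h hM] [k kM] /SetMap_inj /= hk; exact: eq_exist. Qed.

(** Comparing images under [m] avoids transporting morphisms along [F X = F' X]; once the object
    maps are identified, injectivity of [m] gives equality of morphisms. *)
Lemma functor_eq (C D : category) (m : forall X Y : D, hom X Y -> set_map)
    (F F' : functor C D) :
    (forall X Y, injective (@m X Y)) -> (forall X, F X = F' X) ->
    (forall (X Y : C) (u : hom X Y), m _ _ (fmap F u) = m _ _ (fmap F' u)) ->
  F = F'.
Proof.
case: F F' => [F f f1 fM] [G g g1 gM] /= m_inj /funext FG.
case: _ / FG g g1 gM => g g1 gM fg.
have e : f = g.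
  apply: functional_extensionality_dep => X.
  apply: functional_extensionality_dep => Y.
  by apply: funext => u; apply: m_inj; exact: fg.
case: _ / e g1 gM {fg} => g1 gM.
by rewrite (Prop_irrelevance f1 g1) (Prop_irrelevance fM gM).
Qed.

(** * The two functors and their composites *)

Lemma twist_morph (X Y : QA_obj) (h : X -> Y) : QA_morph h ->
  @lq_hom (S2_of_QA X) (S2_of_QA Y) h.
Proof.
move=> [hM hf] x y; have {}hf z : h (QA_aut X z) = QA_aut Y (h z).
  exact: (congr1 (fun k => k z) hf).
by rewrite /= hf hM.
Qed.

(** A homomorphism preserves squares, so it commutes with [s] and hence with [s^-1]. *)
Lemma untwist_morph (S T : S2_obj) (h : S -> T) : lq_hom h ->
  @QA_morph (QA_of_S2 S) (QA_of_S2 T) h.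
Proof.
move=> hM; have hs (x : S) : h (S2_squaring S x) = S2_squaring T (h x).
  exact: hM.
split=> [x y /=|]; last by apply/funext => x; exact: hs.
apply: (canRL (sym_funK (S2_squaring T))).
by rewrite -hs -hM (sym_invK (S2_squaring S)).
Qed.

(** Kept transparent so that its values on objects and morphisms can be computed. *)
Definition S2_functor : functor catQ catS2.
Proof.
refine (@Functor catQ catS2 S2_of_QA
  (fun X Y h => exist _ (sval h) (twist_morph (svalP h))) _ _).
- by move=> X; exact: eq_exist.
- by move=> X Y Z v u; exact: eq_exist.
Defined.

Definition QA_functor : functor catS2 catQ.
Proof.
refine (@Functor catS2 catQ QA_of_S2
  (fun S T h => exist _ (sval h) (untwist_morph (svalP h))) _ _).
- by move=> X; exact: eq_exist.
- by move=> X Y Z v u; exact: eq_exist.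
Defined.

Lemma S2_functorK : functor_comp QA_functor S2_functor = functor_id catQ.
Proof.
apply: (@functor_eq catQ catQ (@QA_map)) => //=; first exact: QA_map_inj.
move=> X; apply: QA_obj_eq.
have opE (x y : X) : (S2_squaring (S2_of_QA X))^-1 (QA_aut X (x *q y)) = x *q y.
  by apply: (canLR (sym_funK _)); exact/esym/twist_squaring.
have sE (x : X) : S2_squaring (S2_of_QA X) x = QA_aut X x.
  exact: twist_squaring.
(* Exposing the carrier and operation of [X] gives the form [LqPerm_eq] needs. *)
case: X opE sE => [[X op b] f qX fX] /= opE sE.
exact: LqPerm_eq.
Qed.

Lemma QA_functorK : functor_comp S2_functor QA_functor = functor_id catS2.
Proof.
apply: (@functor_eq catS2 catS2 (@S2_map)) => //=; first exact: S2_map_inj.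
move=> S; apply: S2_obj_eq; exact: twist_twistV.
Qed.

Theorem proposition3p17 :
  (exists (F : functor catQ catS2) (G : functor catS2 catQ),
     [/\ forall X : QA_obj, S2_lq (F X) = lq_twist X (QA_aut X),
         forall (X Y : QA_obj) (h : QA_hom X Y), S2_map (fmap F h) = QA_map h,
         forall S : S2_obj,
           LqPerm (G S) (QA_aut (G S)) =
           LqPerm (lq_twist S (S2_squaring S)^-1) (S2_squaring S),
         forall (S T : S2_obj) (h : S2_hom S T), QA_map (fmap G h) = S2_map h
       & mutually_inverse F G]) /\
  (forall X : QA_obj, Dis X = Dis (lq_twist X (QA_aut X)) :> set (Sym X)) /\
  (forall S : S2_obj,
     Dis S = Dis (lq_twist S (S2_squaring S)^-1) :> set (Sym S)) /\
  (forall X : QA_obj,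
     rack (lq_twist X (QA_aut X)) <-> centralizer (Aut X) (LMlt X) (QA_aut X)).
Proof.
split; last split; last split.
- exists S2_functor, QA_functor; split=> //.
  by split; [exact: S2_functorK|exact: QA_functorK].
- by move=> X; apply: Dis_twist; [exact: (QA_quandle X).1|exact: QA_autP].
(* [S] is the twist by [s] of its quandle, so the case of quandles applies. *)
- move=> S; rewrite -(Dis_twist_twistV (S2_squaring S)).
  apply/esym/(@Dis_twist (lq_twist S (S2_squaring S)^-1) (S2_squaring S)).
    exact: (untwist_quandle S).1.
  exact: untwist_aut.
- exact: twist_rackP.
Qed.
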